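(* Let $X,Y$ be compact manifolds, and let $f_1:X\to X$ and $f_2:Y\to Y$ be homeomorphisms preserving Borel probability measures $\mu_1,\mu_2$ and having decay rates $\gamma_n,\delta_n$ respectively. Then the product map $f_1\times f_2$ on $X\times Y$ with the product measure $\mu_1\otimes\mu_2$ has decay rate $\max\{\gamma_n,\delta_n\}$.
   Context: For a map $f$ of a compact manifold preserving a probability measure $\mu$, $\operatorname{Cor}_\mu(\psi,\varphi,f^n)=\int\psi\cdot(\varphi\circ f^n)\,d\mu-\int\psi\,d\mu\int\varphi\,d\mu$. We say $f$ has decay (of correlations) with rate $\rho_n$, where $\rho_n\to0$, if for all Hölder continuous $\psi,\varphi$ there is a constant $C_{\psi,\varphi}$ such that $|\operatorname{Cor}_\mu(\psi,\varphi,f^n)|\le C_{\psi,\varphi}\rho_n$ for all $n$. *)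

(* Defs.v *)
From HB Require Import structures.
From mathcomp Require Import all_boot all_order all_algebra.
From mathcomp Require Import all_classical all_reals all_analysis.

Set Implicit Arguments.
Unset Strict Implicit.
Unset Printing Implicit Defensive.

Import Order.TTheory GRing.Theory Num.Theory.
Import numFieldNormedType.Exports.

Local Open Scope classical_set_scope.
Local Open Scope ring_scope.

(* No compatibility between the two structures is built in: see [borel]. *)
#[short(type="measurableMetricType")]
HB.structure Definition MeasurableMetric (d : measure_display)
    (R : numDomainType) := {T of Measurable d T & Metric R T}.

(* The library puts the sup pseudometric on products; its distance is the
   maximum of the two distances.  For Riemannian distances it is bi-Lipschitz
   to the distance of the product Riemannian metric, so both have the same
   Hölder functions. *)
Section prod_metric.
Context {R : realType} {X Y : metricType R}.
Implicit Types p q : (X * Y)%type.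

Definition prod_mdist p q : R := Num.max (mdist p.1 q.1) (mdist p.2 q.2).

Lemma prod_mdist_ge0 p q : 0 <= prod_mdist p q.
Proof. by rewrite le_max mdist_ge0. Qed.

Lemma prod_mdist_positivity p q : prod_mdist p q = 0 -> p = q.
Proof.
case: p q => [x y] [x' y'] /= h.
have : prod_mdist (x, y) (x', y') <= 0 by rewrite h.
rewrite ge_max => /andP[/= hx hy].
congr pair; apply: mdist_positivity; apply/eqP;
  by rewrite eq_le mdist_ge0 ?hx ?hy.
Qed.

Lemma ballE_prod_mdist p e : ball p e = [set q | prod_mdist p q < e].
Proof.
apply/seteqP; split=> q; rewrite /ball/= /prod_ball !ballEmdist /=.
  by case=> h1 h2; rewrite /prod_mdist gt_max h1 h2.
by rewrite /prod_mdist gt_max => /andP[].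
Qed.

HB.instance Definition _ := @PseudoMetric_isMetric.Build R (X * Y)%type
  prod_mdist prod_mdist_ge0 prod_mdist_positivity ballE_prod_mdist.

End prod_metric.

HB.instance Definition _ d1 d2 (R : realType) (X : measurableMetricType d1 R)
  (Y : measurableMetricType d2 R) := Metric.on (X * Y)%type.

Section definitions.
Context {R : realType}.

Definition locally_euclidean (m : nat) (X : topologicalType) :=
  forall x : X, exists (U : set X) (V : set 'rV[R]_m)
      (f : X -> 'rV[R]_m) (g : 'rV[R]_m -> X),
    [/\ open U, U x & open V] /\
    [/\ {within U, continuous f}, {within V, continuous g},
        forall u, U u -> V (f u) /\ g (f u) = u &
        forall v, V v -> U (g v) /\ f (g v) = v].

(* Topological manifolds (without boundary) carrying an arbitrary distance that
   induces the topology.  The Hausdorff and second countability axioms are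
   consequences of compactness and metrizability.  A compact Riemannian
   manifold with its geodesic distance is an instance. *)
Definition compact_manifold (X : metricType R) :=
  compact [set: X] /\ exists m, locally_euclidean m X.

Definition borel d (T : measurableMetricType d R) :=
  @measurable d T = <<s [set A : set T | open A] >>.

Definition homeomorphism (X Y : topologicalType) (f : X -> Y) :=
  continuous f /\ exists g : Y -> X, [/\ continuous g, cancel f g & cancel g f].

Definition measure_preserving d (T : measurableType d)
    (mu : {measure set T -> \bar R}) (f : T -> T) :=
  forall A, measurable A -> mu (f @^-1` A) = mu A.

Definition holder_continuous (X : metricType R) (psi : X -> R) :=
  exists a C : R, [/\ 0 < a, a <= 1 &
    forall x y, `|psi x - psi y| <= C * mdist x y `^ a].

Definition correlation d (T : measurableType d)
    (mu : {measure set T -> \bar R}) (psi phi : T -> R) (f : T -> T) (n : nat)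
    : R :=
  (\int[mu]_x (psi x * phi (iter n f x))
     - (\int[mu]_x psi x) * (\int[mu]_x phi x))%R.

(* A rate is a nonnegative sequence tending to 0; with signed sequences and a
   signed constant [C] the bound would not behave as a rate. *)
Definition has_decay_rate d (T : measurableMetricType d R)
    (mu : {measure set T -> \bar R}) (f : T -> T) (rho : R^nat) :=
  [/\ forall n, 0 <= rho n, rho n @[n --> \oo] --> (0 : R) &
      forall psi phi : T -> R,
        holder_continuous psi -> holder_continuous phi ->
        exists C : R, forall n, `|correlation mu psi phi f n| <= C * rho n].

Definition product_map (X Y : Type) (f : X -> X) (g : Y -> Y) (z : X * Y)
    : X * Y := (f z.1, g z.2).

End definitions.

(* Main.v *)
Require Import Defs.
From HB Require Import structures.
From mathcomp Require Import all_boot all_order all_algebra.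
From mathcomp Require Import all_classical all_reals all_analysis.
From mathcomp Require Import measurable_realfun ring lra.

Set Implicit Arguments.
Unset Strict Implicit.
Unset Printing Implicit Defensive.

Import Order.TTheory GRing.Theory Num.Theory.
Import numFieldNormedType.Exports.

Local Open Scope classical_set_scope.
Local Open Scope ring_scope.

(* The decay estimate holds with a constant depending on the observables only
   through their Hölder norms: this is the uniform boundedness principle
   applied to the bilinear maps [psi, phi |-> Cor_n(psi, phi) / gamma n].
   With [Psi y] and [Phi y] the integrals over [X] of [psi (x, y)] and
   [phi (x, y)], Fubini then gives
     Cor_n(psi, phi) = \int_y Cor1_n(psi(., y), phi(., f2^n y))
                       + Cor2_n(Psi, Phi),
   where the first term is [O(gamma n)] by uniformity in [y] and the second is
   [O(delta n)] because [Psi] and [Phi] are again Hölder. *)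

(** * Balls of the Hölder space and the uniform boundedness principle *)

Section holder_ball.
Context {R : realType} {X : metricType R}.
Implicit Types (f g psi phi : X -> R) (a b c r s : R).

(** The closed ball of radius [r] for the Hölder norm of exponent [a], taken as the maximum of the
    sup norm and the Hölder seminorm. The condition [0 <= r] keeps radii nonnegative on an empty
    space too. *)
Definition holder_ball a r psi :=
  [/\ 0 <= r, forall x, `|psi x| <= r &
      forall x y, `|psi x - psi y| <= r * mdist x y `^ a].

Definition bounded_holder a psi := exists r, holder_ball a r psi.

Lemma holder_ball0 a : holder_ball a 0 (fun=> 0).
Proof. by split=> // *; rewrite ?subrr normr0 ?mul0r. Qed.

Lemma holder_ballD a r s f g : holder_ball a r f -> holder_ball a s g ->
  holder_ball a (r + s) (fun x => f x + g x).
Proof.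
move=> [r0 fr fh] [s0 gs gh]; split=> [|x|x y]; first exact: addr_ge0.
  by rewrite (le_trans (ler_normD _ _))// lerD.
by rewrite opprD addrACA (le_trans (ler_normD _ _))// mulrDl lerD.
Qed.

Lemma holder_ballZ a r c f : holder_ball a r f ->
  holder_ball a (`|c| * r) (fun x => c * f x).
Proof.
move=> [r0 fr fh]; split=> [|x|x y]; first exact: mulr_ge0.
  by rewrite normrM ler_wpM2l.
by rewrite -mulrBr normrM -mulrA ler_wpM2l.
Qed.

Lemma holder_ballW a r s f : r <= s -> holder_ball a r f -> holder_ball a s f.
Proof.
move=> rs [r0 fr fh]; split=> [|x|x y]; first exact: le_trans rs.
  exact: le_trans rs.
by rewrite (le_trans (fh x y))// ler_wpM2r// powR_ge0.
Qed.

(** Each inequality defining the ball is a closed condition on the values at one or two points, so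
    pointwise limits stay in the ball. *)
Lemma holder_ball_cvg a r (u : nat -> X -> R) f :
  (forall x, u n x @[n --> \oo] --> f x) ->
  (\forall n \near \oo, holder_ball a r (u n)) -> holder_ball a r f.
Proof.
move=> uf [N _ Hu]; split=> [|x|x y].
- by have [] := Hu N (leqnn N).
- apply: (@cvgr_to_le _ \oo _ _ (fun n => `|u n x|)); first exact: cvg_norm.
  by exists N => // n /Hu[].
- apply: (@cvgr_to_le _ \oo _ _ (fun n => `|u n x - u n y|)).
    by apply: cvg_norm; apply: cvgB; exact: uf.
  by exists N => // n /Hu[].
Qed.

Lemma bounded_holderDZ a c f g : bounded_holder a f -> bounded_holder a g ->
  bounded_holder a (fun x => f x + c * g x).
Proof.
move=> [r fr] [s gs]; exists (r + `|c| * s); apply: holder_ballD => //.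
exact: holder_ballZ.
Qed.

End holder_ball.
Arguments holder_ball {R X}.
Arguments bounded_holder {R X}.

(* Sokal's proof of the uniform boundedness principle. *)
Lemma holder_uniform_boundedness (R : realType) (X : metricType R) (I : Type)
    (a : R) (T : I -> (X -> R) -> R) (M : I -> R) :
  (forall i c f g, bounded_holder a f -> bounded_holder a g ->
     T i (fun x => f x + c * g x) = T i f + c * T i g) ->
  (forall i r f, holder_ball a r f -> `|T i f| <= M i * r) ->
  (forall f, bounded_holder a f -> exists C, forall i, `|T i f| <= C) ->
  exists K, 0 <= K /\ forall i r f, holder_ball a r f -> `|T i f| <= K * r.
Proof.
move=> Tlin TM Tptw.
have bh0 : bounded_holder a (fun _ : X => 0 : R).
  by exists 0; exact: holder_ball0.
(* [N i] is the operator norm of [T i], finite by [TM]. *)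
pose S i := [set `|T i f| | f in holder_ball a 1].
pose N i := sup (S i).
have supS i : has_sup (S i).
  split; first by exists `|T i (fun=> 0)|, (fun=> 0) => //;
    exact: holder_ballW (holder_ball0 a).
  by exists (M i) => _ [f fb <-]; rewrite (le_trans (TM _ _ _ fb))// mulr1.
have N0 i : 0 <= N i.
  have [[_ [f fb _]] ub] := supS i.
  by apply: (le_trans (normr_ge0 (T i f))); apply: ub_le_sup => //; exists f.
have T0 i : T i (fun=> 0) = 0.
  apply/eqP; rewrite -normr_le0.
  by rewrite (le_trans (TM _ _ _ (holder_ball0 a)))// mulr0.
have TZ i c f : bounded_holder a f -> T i (fun x => c * f x) = c * T i f.
  move=> bf; have := Tlin i c _ _ bh0 bf; rewrite T0 add0r => <-.
  by congr (T i _); apply/funext => x; rewrite add0r.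
have TN i r f : holder_ball a r f -> `|T i f| <= N i * r.
  move=> fr; have [r0 _ _] := fr.
  have [r_eq0|r_neq0] := eqVneq r 0.
    by rewrite r_eq0 mulr0; have := TM i _ _ fr; rewrite r_eq0 mulr0.
  have rgt0 : 0 < r by rewrite lt_neqAle eq_sym r_neq0.
  rewrite -ler_pdivrMr// mulrC -[r^-1]ger0_norm ?invr_ge0//.
  rewrite -normrM -TZ; last by exists r.
  have [_ ub] := supS i.
  apply: ub_le_sup => //; exists (fun x => r^-1 * f x) => //.
  by have := holder_ballZ r^-1 fr; rewrite ger0_norm ?invr_ge0// mulVf.
suff [K NK] : exists K, forall i, N i <= K.
  (* The maximum with 0 serves the case of an empty [I], where [NK] does not force [K] to be
     nonnegative. *)
  exists (Num.max 0 K); split=> [|i r f fr]; first by rewrite le_max lexx.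
  rewrite (le_trans (TN i r f fr))// ler_wpM2r//; first by case: fr.
  by rewrite le_max NK orbT.
apply: contrapT => unbdd.
have large (K : R) : exists i, K < N i.
  by apply: contrapT => nK; apply: unbdd; exists K => i; rewrite leNgt;
    apply/negP => Ki; apply: nK; exists i.
(* Step sizes with ratio 1/3: all steps after stage [n] add up to [q n / 2]. *)
pose q n : R := 3^-1 ^+ n.
have q0 n : 0 < q n by rewrite exprn_gt0.
have qS n : q n.+1 = q n / 3 by rewrite /q exprSr.
(* The constants 2/3 and 6 fit together: a gain of 2/3 against a tail of 1/2 leaves 1/6 of
   [q n.+1 * N], which the choice of the index makes larger than [n]. *)
have /choice[ix Hix] : forall n, exists p : I * (X -> R),
    [/\ (6 / q n.+1) * n%:R < N p.1, holder_ball a 1 p.2 &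
        2 / 3 * N p.1 < `|T p.1 p.2|].
  move=> n; have [i Ni] := large ((6 / q n.+1) * n%:R).
  have Ni0 : 0 < N i.
    by apply: le_lt_trans Ni; rewrite mulr_ge0// divr_ge0// ltW.
  have := sup_adherent (_ : 0 < N i / 3) (supS i).
  rewrite divr_gt0// => /(_ isT)[_ [f fb <-]] Tf.
  exists (i, f); split=> //=; apply: le_lt_trans Tf.
  rewrite -/(N i); lra.
pose t n := T (ix n).1; pose xi n := (ix n).2.
have xib n : bounded_holder a (xi n) by exists 1; case: (Hix n).
(* The sign is the one that makes [t n] larger in absolute value on [v + c n v * xi n]. The larger
   of the two candidates is at least their mean, hence at least [q n.+1 * |t n (xi n)|], whatever
   [v] is. *)
pose c n (v : X -> R) := if `|t n v - q n.+1 * t n (xi n)| <=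
  `|t n v + q n.+1 * t n (xi n)| then q n.+1 else - q n.+1.
pose u := fix u n := if n is m.+1
  then (fun x => u m x + c m (u m) * xi m x) else (fun=> 0).
have uS n : u n.+1 = fun x => u n x + c n (u n) * xi n x by [].
have normc n v : `|c n v| = q n.+1.
  by rewrite /c; case: ifP => _; rewrite ?normrN gtr0_norm.
have ub n : bounded_holder a (u n).
  by elim: n => [|n IHn]//; rewrite uS; exact: bounded_holderDZ.
have tu n : q n.+1 * `|t n (xi n)| <= `|t n (u n.+1)|.
  rewrite uS [in leRHS]/t Tlin// -/(t n) /c.
  rewrite -[q n.+1 in leLHS]gtr0_norm// -normrM.
  set y := q n.+1 * _; set z := t n _.
  have tri : `|y| *+ 2 <= `|z + y| + `|z - y|.
    rewrite -normrMn; have -> : y *+ 2 = (z + y) - (z - y) by ring.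
    exact: ler_normB.
  by case: ifPn => [|/negP/negP]; rewrite ?mulNr -/y -?ltNge; lra.
(* The radius telescopes, because [q j.+1 = (q j - q j.+1) / 2]. *)
have uball n k : holder_ball a (2^-1 * (q n - q (n + k)%N))
    (fun x => u (n + k)%N x - u n x).
  elim: k => [|k IHk].
    rewrite addn0 subrr mulr0 (_ : (fun x => _) = fun=> 0);
      [exact: holder_ball0|by apply/funext => x; rewrite subrr].
  rewrite addnS.
  have [_ xi1 _] := Hix (n + k)%N.
  have := holder_ballD IHk (holder_ballZ (c (n + k)%N (u (n + k)%N)) xi1).
  rewrite normc mulr1 => H.
  have -> : 2^-1 * (q n - q (n + k).+1) =
      2^-1 * (q n - q (n + k)%N) + q (n + k).+1 by rewrite qS; field.
  suff -> : (fun x => u (n + k).+1 x - u n x) =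
      (fun x : X => u (n + k)%N x - u n x +
         c (n + k)%N (u (n + k)%N) * (ix (n + k)%N).2 x) by [].
  by apply/funext => x; rewrite uS /xi; ring.
have uball' n m : (n <= m)%N ->
    holder_ball a (2^-1 * q n) (fun x => u m x - u n x).
  move=> nm; rewrite -(subnKC nm); apply: holder_ballW (uball _ _).
  by rewrite ler_wpM2l// gerBl ltW.
have q_cvg : q n @[n --> \oo] --> (0 : R).
  by rewrite /q; apply: cvg_expr; rewrite ger0_norm// invf_lt1// ltr1n.
(* Completeness of the Hölder space is obtained by hand: limits exist pointwise in [R], and balls
   are closed under pointwise limits. *)
have ucvg x : cvg (u n x @[n --> \oo]).
  apply/cauchy_cvgP/cauchy_ballP => e e0.
  have [n _ /(_ n (leqnn n))/= qe] := cvgr_lt _ q_cvg _ e0.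
  pose B := [set v : R | `|v - u n x| <= 2^-1 * q n].
  have nB : \forall m \near \oo, B (u m x).
    by exists n => // m /= nm; have [_ + _] := uball' _ _ nm; exact.
  exists (B, B) => // -[v1 v2] [/= b1 b2]; rewrite -ball_normE /=.
  rewrite (_ : v1 - v2 = (v1 - u n x) - (v2 - u n x)); last by ring.
  rewrite (le_lt_trans (ler_normB _ _))// (le_lt_trans _ qe)//.
  by move: b1 b2; rewrite /B /=; lra.
pose l x := lim (u n x @[n --> \oo]).
have lb n : holder_ball a (2^-1 * q n) (fun x => l x - u n x).
  apply: (holder_ball_cvg (u := fun m x => u m x - u n x)).
    by move=> x; have := cvgB (ucvg x) (cvg_cst (u n x)); exact.
  by exists n => // m /=; exact: uball'.
have bl : bounded_holder a l.
  exists (2^-1 * q 0%N); have := lb 0%N.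
  by congr (holder_ball a _); apply/funext => x /=; rewrite subr0.
have [C HC] := Tptw _ bl.
suff : forall n, n%:R <= C.
  move=> /(_ (Num.trunc C).+1); apply/negP; rewrite -ltNge.
  exact: truncnS_gt.
(* With [N] the norm at index [(ix n).1], the value at [u n.+1] is at least [q n.+1 * (2 / 3 * N)]
   and the remainder at most [q n.+1 * N / 2]. The difference [q n.+1 * N / 6] is at least [n], so
   the values at [l] are unbounded. *)
move=> n; apply: le_trans (HC (ix n).1).
have [large_n _ xin] := Hix n.
have lu : T (ix n).1 l = t n (u n.+1) + t n (fun x => l x - u n.+1 x).
  rewrite -[X in _ + X]mul1r -Tlin//; last by exists (2^-1 * q n.+1).
  by congr (T _ _); apply/funext => x /=; ring.
have h1 := tu n.
have h2 := TN (ix n).1 _ _ (lb n.+1).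
have h3 : q n.+1 * (2 / 3 * N (ix n).1) <= q n.+1 * `|t n (xi n)|.
  by rewrite ler_pM2l// ltW.
have h4 : n%:R * 6 <= q n.+1 * N (ix n).1.
  by move: large_n; rewrite mulrAC ltr_pdivrMr// (mulrC (N _)) mulrC; lra.
have h5 : `|t n (u n.+1)| <= `|T (ix n).1 l| + `|t n (fun x => l x - u n.+1 x)|.
  by rewrite lu (le_trans _ (ler_normB _ _))// addrK.
rewrite /t in h1 h2 h3 h5 *; nra.
Qed.

(** * Hölder functions on compact spaces *)

Section holder_compact.
Context {R : realType} {X : metricType R}.
Implicit Types (psi : X -> R) (a r e : R).

Lemma powR_small a e : 0 < a -> 0 < e ->
  exists2 delta, 0 < delta & forall t, 0 <= t -> t < delta -> t `^ a < e.
Proof.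
move=> a0 e0; exists (e `^ a^-1); first exact: powR_gt0.
move=> t t0 te; rewrite -[ltRHS]powRr1 ?ltW// -(mulVf (lt0r_neq0 a0)) powRrM.
by apply: gt0_ltr_powR => //; rewrite nnegrE ?powR_ge0.
Qed.

Lemma holder_uniformly_continuous psi e : holder_continuous psi -> 0 < e ->
  exists2 delta, 0 < delta &
    forall x y, mdist x y < delta -> `|psi x - psi y| < e.
Proof.
move=> [a [C [a0 _ H]]] e0.
(* [C] may be zero or negative, so a positive majorant is used as divisor. *)
have C0 : 0 < `|C| + 1 by rewrite ltr_wpDl.
have [delta delta0 Hd] := powR_small a0 (divr_gt0 e0 C0).
exists delta => // x y xy; rewrite (le_lt_trans (H x y))//.
have := Hd _ (mdist_ge0 x y) xy; rewrite ltr_pdivlMr//.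
move=> /(le_lt_trans _); apply.
by rewrite mulrC ler_wpM2l ?powR_ge0// (le_trans (ler_norm _))// lerDl.
Qed.

Lemma holder_continuous_continuous psi :
  holder_continuous psi -> continuous psi.
Proof.
move=> hpsi x; apply/cvgrPdist_lt => e e0.
have [delta delta0 H] := holder_uniformly_continuous hpsi e0.
by apply/nbhs_ballP; exists delta => // y; rewrite ballEmdist; exact: H.
Qed.

(** Compactness bounds the continuous function [psi], so a finite seminorm gives a finite norm; the
    sum of the two bounds serves as the single radius. *)
Lemma holder_continuousP psi : compact [set: X] ->
  holder_continuous psi <->
  exists a r, [/\ 0 < a, a <= 1 & holder_ball a r psi].
Proof.
move=> cX; split=> [hpsi|[a [r [a0 a1 [_ _ H]]]]]; last by exists a, r.
have [a [C [a0 a1 H]]] := hpsi.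
have /compact_bounded[M [_ HM]] := continuous_compact
  (continuous_subspaceT (holder_continuous_continuous hpsi)) cX.
have M1 : M < `|M| + 1 by rewrite (le_lt_trans (ler_norm _))// ltrDl.
exists a, (`|M| + 1 + `|C|); split=> //; split=> [|x|x y].
- by rewrite !addr_ge0.
- by rewrite (le_trans (HM _ M1 _ _))// lerDl.
- rewrite (le_trans (H x y))// ler_wpM2r ?powR_ge0//.
  by rewrite (le_trans (ler_norm _))// lerDr addr_ge0.
Qed.

End holder_compact.

(** * Borel measurability on spaces and on products *)

Section borel_measurability.
Context {R : realType}.

Lemma borel_open d (T : measurableMetricType d R) (A : set T) :
  borel T -> open A -> measurable A.
Proof. by rewrite /borel => -> oA; exact: sub_gen_smallest. Qed.

Lemma borel_continuous_measurable d d' (T : measurableMetricType d R)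
    (U : measurableMetricType d' R) (f : T -> U) :
  borel T -> borel U -> continuous f -> measurable_fun setT f.
Proof.
move=> bT bU /continuousP cf; apply: (measurability _ bU).
by move=> _ [A oA <-]; rewrite setTI; exact/(borel_open bT)/cf.
Qed.

Lemma borel_continuous_measurableR d (T : measurableMetricType d R)
    (f : T -> R) : borel T -> continuous f -> measurable_fun setT f.
Proof.
move=> bT /continuousP cf; apply: (measurability _ (RGenOpens.measurableE R)).
move=> _ [A [a [b ->]] <-]; rewrite setTI; apply: (borel_open bT).
by apply: cf; exact: interval_open.
Qed.

(** Near-covering compactness is applied to the filter of finite sets directed by inclusion: every
    finite set containing [x] covers the neighbourhood [(ball x e)°] of [x]. Interiors make the
    covering sets open, hence Borel. *)
Lemma ball_net (X : metricType R) (e : R) : compact [set: X] -> 0 < e ->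
  exists2 D : set X, finite_set D & forall x, exists2 p, D p & (ball p e)° x.
Proof.
move=> /compact_near_coveringP cX e0.
pose F : set_system (set X) := filter_from finite_set
  (fun D => [set E | finite_set E /\ D `<=` E]).
have FF : Filter F.
  apply: filter_from_filter; first by exists set0; exact: finite_set0.
  move=> A B fA fB; exists (A `|` B); first by rewrite finite_setU.
  by move=> E [fE ABE]; split; split=> // x ?; apply: ABE; [left|right].
pose P (D : set X) x := exists2 p, D p & (ball p e)° x.
have [x _|D fD cD] := cX _ F P FF.
  exists ((ball x e)°, [set D | D x]); first split=> /=.
  - by apply: open_nbhs_nbhs; split; [exact: open_interior|exact: nbhsx_ballx].
  - by exists [set x] => // D [_]; exact.
  - by move=> [y D] [/= xy Dx]; exists x.
by exists D => // x; have /(_ x I) := cD D (conj fD (@subset_refl _ D)).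
Qed.

(* The set [psi > c] is the union of the rectangles
   [ball p delta `*` [set y | c + k^-1 < psi (p, y)]], for [k] a positive
   integer and [p] in a finite [delta]-net of [X], where [delta] is a modulus
   of continuity of [psi] at scale [k^-1]. *)
Lemma measurable_fun_uniform_continuous1 d1 d2
    (X : measurableMetricType d1 R) (Y : measurableType d2)
    (psi : X * Y -> R) :
  compact [set: X] -> borel X ->
  (forall e, 0 < e -> exists2 delta, 0 < delta & forall x x' y,
    mdist x x' < delta -> `|psi (x, y) - psi (x', y)| < e) ->
  (forall x, measurable_fun setT (fun y => psi (x, y))) ->
  measurable_fun setT psi.
Proof.
move=> cX bX uc mpsi; apply: (measurability _ (RGenOInfty.measurableE R)).
move=> _ [_ [c ->] <-]; rewrite setTI.
have /choice[D HD] : forall k : nat, exists D : R * set X,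
    [/\ finite_set D.2, forall x, exists2 p, D.2 p & (ball p D.1)° x &
     forall x x' y, mdist x x' < D.1 ->
       `|psi (x, y) - psi (x', y)| < k.+1%:R^-1].
  move=> k; have [|delta delta0 Hd] := uc k.+1%:R^-1; first by [].
  by have [D fD cD] := ball_net cX delta0; exists (delta, D).
rewrite (_ : psi @^-1` _ = \bigcup_k \bigcup_(p in (D k).2)
    ((ball p (D k).1)° `*` [set y | c + k.+1%:R^-1 < psi (p, y)])).
  apply: bigcupT_measurable => k; have [fD _ _] := HD k.
  apply: fin_bigcup_measurable => // p _; apply: measurableX.
    by apply: (borel_open bX); exact: open_interior.
  rewrite -[X in measurable X]setTI.
  rewrite (_ : [set y | _] =
    (fun y => psi (p, y)) @^-1` `]c + k.+1%:R^-1, +oo[); last first.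
    by apply/seteqP; split=> y /=; rewrite in_itv/= andbT.
  exact: mpsi.
apply/seteqP; split=> [[x y]|[x y] [k _ [p _ [/= /interior_subset px pc]]]].
  rewrite /= in_itv/= andbT => cpsi.
  (* Half of the gap [psi (x, y) - c] pays for moving from [x] to [p], the other half for the margin
     [k.+1%:R^-1] in the rectangle. *)
  have [k kpsi] : exists k, k.+1%:R^-1 < (psi (x, y) - c) / 2.
    have : 0 < (psi (x, y) - c) / 2 by rewrite divr_gt0// subr_gt0.
    by move=> /ltr_add_invr[k]; rewrite add0r; exists k.
  have [_ /(_ x)[p Dp px] Hd] := HD k.
  exists k => //; exists p => //; split=> //=.
  have := interior_subset px; rewrite ballEmdist => /(Hd p x y).
  rewrite ltr_norml => /andP[+ _]; move: kpsi.
  by move: (psi (x, y)) (psi (p, y)) k.+1%:R^-1 => u v w; lra.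
have [_ _ Hd] := HD k; move: px; rewrite ballEmdist => /(Hd p x y).
rewrite ltr_norml => /andP[_].
rewrite /= in_itv/= andbT; move: pc.
by move: (psi (x, y)) (psi (p, y)) k.+1%:R^-1 => u v w; lra.
Qed.
End borel_measurability.

(** * Integrals of bounded functions and Fubini's theorem *)

Section probability_integral.
Context {R : realType} d {T : measurableType d} (mu : probability T R).
Implicit Types (f g : T -> R).

Lemma bounded_integrable f r : measurable_fun setT f ->
  (forall x, `|f x| <= r) -> mu.-integrable setT (EFin \o f).
Proof.
move=> mf fr; apply: measurable_bounded_integrable => //.
  by rewrite [ltLHS]probability_setT ltry.
by exists r; split=> [|M rM x _]; [exact: num_real|exact/(le_trans (fr x))/ltW].
Qed.

Lemma Rintegral_probability_cst r : \int[mu]_x r = r.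
Proof. by rewrite Rintegral_cst// [X in fine X]probability_setT mulr1. Qed.

Lemma le_norm_Rintegral_probability f r : measurable_fun setT f ->
  (forall x, `|f x| <= r) -> `|\int[mu]_x f x| <= r.
Proof.
move=> mf fr; have intf := bounded_integrable mf fr.
rewrite (le_trans (le_normr_Rintegral _ intf))//.
rewrite -[leRHS]Rintegral_probability_cst.
apply: le_Rintegral => //; last exact: finite_measure_integrable_cst.
by apply: (@bounded_integrable _ r) => [|x];
  [exact: measurableT_comp|rewrite normr_id].
Qed.

End probability_integral.

Section bounded_fubini.
Context {R : realType} {d1 d2 : measure_display} {X : measurableType d1}
  {Y : measurableType d2} (mu1 : probability X R) (mu2 : probability Y R).
Variables (h : X * Y -> R) (r : R).
Hypotheses (mh : measurable_fun setT h) (hr : forall z, `|h z| <= r).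

Let inth : (mu1 \x mu2)%E.-integrable setT (EFin \o h).
Proof. exact: (bounded_integrable (mu1 \x mu2)%E mh hr). Qed.

Lemma measurable_fun_Rintegral1 :
  measurable_fun setT (fun y => \int[mu1]_x h (x, y)).
Proof.
apply: measurableT_comp; first exact: fine_measurable.
exact: (measurable_fubini_G inth).
Qed.

Lemma bounded_Fubini :
  \int[(mu1 \x mu2)%E]_z h z = \int[mu2]_y \int[mu1]_x h (x, y).
Proof.
rewrite /Rintegral -(integral21_prod_meas1 inth); congr fine.
(* The real-valued inner integral is [fine] of the extended one; boundedness makes it finite, so no
   value is lost. *)
apply: eq_integral => y _; rewrite fineK//.
apply: integrable_fin_num => //.
apply: (@bounded_integrable _ _ _ mu1 _ r) => //.
exact: measurable_fun_pair1.
Qed.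

End bounded_fubini.

(** * Bilinearity of correlations and uniform decay *)

Section correlation_theory.
Context {R : realType} d {T : measurableType d} (mu : probability T R).
Variable f : T -> T.
Hypothesis mf : measurable_fun setT f.
Implicit Types (psi phi : T -> R).

(** A class closed under products and under composition with iterates of [f], on which every
    integral in a correlation is finite. *)
Definition bounded_measurable psi :=
  measurable_fun setT psi /\ exists r, forall x, `|psi x| <= r.

Lemma bounded_measurable_integrable psi :
  bounded_measurable psi -> mu.-integrable setT (EFin \o psi).
Proof. by move=> [mpsi [r psir]]; exact: bounded_integrable psir. Qed.

Lemma bounded_measurableM psi phi : bounded_measurable psi ->
  bounded_measurable phi -> bounded_measurable (fun x => psi x * phi x).
Proof.
move=> [mpsi [r psir]] [mphi [s phis]]; split; first exact: measurable_funM.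
by exists (r * s) => x; rewrite normrM ler_pM.
Qed.

Lemma bounded_measurable_cst r : bounded_measurable (fun=> r).
Proof. by split; [exact: measurable_cst|exists `|r|]. Qed.

Lemma measurable_fun_iter n : measurable_fun setT (iter n f).
Proof.
by elim: n => [|n IHn]; [exact: measurable_id|exact: measurableT_comp].
Qed.

Lemma bounded_measurable_iter n phi : bounded_measurable phi ->
  bounded_measurable (fun x => phi (iter n f x)).
Proof.
move=> [mphi [s phis]]; split; last by exists s.
by apply: measurableT_comp => //; exact: measurable_fun_iter.
Qed.

(** Additivity and homogeneity in one identity, the form of linearity that
    [holder_uniform_boundedness] takes; [c = -1] gives differences. *)
Lemma RintegralDZ c psi phi :
  bounded_measurable psi -> bounded_measurable phi ->
  \int[mu]_x (psi x + c * phi x) = \int[mu]_x psi x + c * \int[mu]_x phi x.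
Proof.
move=> bpsi bphi; rewrite RintegralD//; first last.
- apply: bounded_measurable_integrable; apply: bounded_measurableM => //.
  exact: bounded_measurable_cst.
- exact: bounded_measurable_integrable.
- by rewrite RintegralZl//; exact: bounded_measurable_integrable.
Qed.

Lemma correlationDZl n c psi1 psi2 phi : bounded_measurable psi1 ->
  bounded_measurable psi2 -> bounded_measurable phi ->
  correlation mu (fun x => psi1 x + c * psi2 x) phi f n =
  correlation mu psi1 phi f n + c * correlation mu psi2 phi f n.
Proof.
move=> b1 b2 b; rewrite /correlation RintegralDZ//.
under eq_Rintegral do rewrite mulrDl -mulrA.
rewrite RintegralDZ; first ring.
all: by apply: bounded_measurableM => //; exact: bounded_measurable_iter.
Qed.

Lemma correlationDZr n c psi phi1 phi2 : bounded_measurable psi ->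
  bounded_measurable phi1 -> bounded_measurable phi2 ->
  correlation mu psi (fun x => phi1 x + c * phi2 x) f n =
  correlation mu psi phi1 f n + c * correlation mu psi phi2 f n.
Proof.
move=> b b1 b2; rewrite /correlation RintegralDZ//.
under eq_Rintegral do rewrite mulrDr mulrCA.
rewrite RintegralDZ; first ring.
all: by apply: bounded_measurableM => //; exact: bounded_measurable_iter.
Qed.

Lemma correlationZr n c psi phi : bounded_measurable psi ->
  bounded_measurable phi ->
  correlation mu psi (fun x => c * phi x) f n = c * correlation mu psi phi f n.
Proof.
move=> bpsi bphi; rewrite /correlation.
under eq_Rintegral do rewrite mulrCA.
rewrite !RintegralZl//; first ring.
  apply: bounded_measurable_integrable; apply: bounded_measurableM => //.
  exact: bounded_measurable_iter.
exact: bounded_measurable_integrable.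
Qed.

(** Gives the continuity of each single functional, a prerequisite for uniform boundedness. *)
Lemma le_norm_correlation n psi phi r s : measurable_fun setT psi ->
  measurable_fun setT phi -> (forall x, `|psi x| <= r) ->
  (forall x, `|phi x| <= s) -> `|correlation mu psi phi f n| <= 2 * (r * s).
Proof.
move=> mpsi mphi psir phis.
rewrite /correlation (le_trans (ler_normB _ _))// mulr_natl mulr2n lerD//.
  apply: le_norm_Rintegral_probability => [|x].
    apply: measurable_funM => //; apply: measurableT_comp => //.
    exact: measurable_fun_iter.
  by rewrite normrM ler_pM.
by rewrite normrM ler_pM// le_norm_Rintegral_probability.
Qed.

End correlation_theory.

(* The uniform boundedness principle is applied twice: first in [phi] for
   each fixed [psi], then in [psi] for the family of functionals indexed by
   [n] and by [phi] in the unit ball. *)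
Lemma uniform_decay (R : realType) d (T : measurableMetricType d R)
    (mu : probability T R) (f : T -> T) (rho : R^nat) (a b : R) :
  compact [set: T] -> borel T -> measurable_fun setT f ->
  has_decay_rate mu f rho -> 0 < a -> a <= 1 -> 0 < b -> b <= 1 ->
  exists K, 0 <= K /\ forall n psi phi r s,
    holder_ball a r psi -> holder_ball b s phi ->
    `|correlation mu psi phi f n| <= K * r * s * rho n.
Proof.
move=> cT bT mf [rho0 _ decay] a0 a1 b0 b1.
have bh_bm c (psi : T -> R) : 0 < c -> c <= 1 -> bounded_holder c psi ->
    bounded_measurable psi.
  move=> c0 c1 [r hpsi]; split; last by case: hpsi => _; exists r.
  apply: (borel_continuous_measurableR bT).
  apply: holder_continuous_continuous.
  by apply/(holder_continuousP _ cT); exists c, r.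
have bh_h c (psi : T -> R) : 0 < c -> c <= 1 -> bounded_holder c psi ->
    holder_continuous psi.
  by move=> c0 c1 [r ?]; apply/(holder_continuousP _ cT); exists c, r.
(* where [rho n = 0] the correlation vanishes, so the junk value
   [x / 0 = 0] loses nothing *)
pose Q n (psi phi : T -> R) := correlation mu psi phi f n / rho n.
have ptw psi phi : bounded_holder a psi -> bounded_holder b phi ->
    exists C, forall n, `|Q n psi phi| <= C.
  move=> hpsi hphi.
  have [C HC] := decay _ _ (bh_h _ _ a0 a1 hpsi) (bh_h _ _ b0 b1 hphi).
  exists `|C| => n; rewrite /Q normrM normfV (ger0_norm (rho0 n)).
  have [->|rhon] := eqVneq (rho n) 0; first by rewrite invr0 mulr0.
  rewrite ler_pdivrMr ?lt_neqAle 1?eq_sym ?rhon ?rho0//.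
  by rewrite (le_trans (HC n))// ler_wpM2r// ler_norm.
have Qbound n psi phi r s : holder_ball a r psi -> holder_ball b s phi ->
    `|Q n psi phi| <= 2 * (r * s) * `|(rho n)^-1|.
  move=> hpsi hphi; rewrite normrM ler_wpM2r//.
  have [|mpsi _] := bh_bm _ psi a0 a1; first by exists r.
  have [|mphi _] := bh_bm _ phi b0 b1; first by exists s.
  have [_ psir _] := hpsi; have [_ phis _] := hphi.
  exact: le_norm_correlation.
have unif1 psi : bounded_holder a psi -> exists C, forall n phi,
    holder_ball b 1 phi -> `|Q n psi phi| <= C.
  move=> [r hpsi].
  have bpsi : bounded_holder a psi by exists r.
  have [n c g1 g2 h1 h2|n s g hg|g hg|K [_ HK]] :=
      @holder_uniform_boundedness R T nat b (fun n => Q n psi)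
        (fun n => 2 * r * `|(rho n)^-1|).
  - rewrite /Q correlationDZr//; first by rewrite mulrDl mulrA.
    + exact: bh_bm bpsi.
    + exact: bh_bm h1.
    + exact: bh_bm h2.
  - by have := Qbound n _ _ _ _ hpsi hg; rewrite mulrA mulrAC.
  - exact: ptw.
  - by exists K => n phi hphi; rewrite (le_trans (HK n _ _ hphi))// mulr1.
(* With [phi] confined to the unit ball, the bound on each functional depends on [n] alone. *)
pose I := (nat * {phi : T -> R | holder_ball b 1 phi})%type.
have [i c g1 g2 h1 h2|i r g hg|g hg|K [K0 HK]] :=
    @holder_uniform_boundedness R T I a (fun i psi => Q i.1 psi (sval i.2))
      (fun i => 2 * `|(rho i.1)^-1|).
- have bphi : bounded_holder b (sval i.2) by exists 1; exact: svalP.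
  rewrite /Q correlationDZl//; first by rewrite mulrDl mulrA.
  + exact: bh_bm h1.
  + exact: bh_bm h2.
  + exact: bh_bm bphi.
- have := Qbound i.1 _ _ _ _ hg (svalP i.2).
  by rewrite mulr1 mulrAC.
- have [C HC] := unif1 _ hg.
  by exists C => -[n [phi hphi]]; exact: HC.
exists K; split=> // n psi phi r s hpsi hphi.
have [s0 phis _] := hphi.
have bpsi : bounded_holder a psi by exists r.
have bphi : bounded_holder b phi by exists s.
have [rhon|rhon] := eqVneq (rho n) 0.
  have [C HC] := decay _ _ (bh_h _ _ a0 a1 bpsi) (bh_h _ _ b0 b1 bphi).
  by rewrite (le_trans (HC n))// rhon !mulr0.
have QE : correlation mu psi phi f n = Q n psi phi * rho n by rewrite /Q divfK.
rewrite QE normrM (ger0_norm (rho0 n)) ler_wpM2r//.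
have Kr0 : 0 <= K * r by rewrite mulr_ge0//; case: hpsi.
(* For [s] nonzero, [phi] is rescaled by [s^-1] into the unit ball; the case [s = 0] needs the
   direct bound. *)
have [s_eq0|s_neq0] := eqVneq s 0.
  rewrite s_eq0 mulr0; have := Qbound n _ _ _ _ hpsi hphi.
  by rewrite s_eq0 !mulr0 mul0r.
have sgt0 : 0 < s by rewrite lt_neqAle eq_sym s_neq0.
have hphi' : holder_ball b 1 (fun x => s^-1 * phi x).
  by have := holder_ballZ s^-1 hphi; rewrite ger0_norm ?invr_ge0// mulVf.
have := HK (n, exist _ _ hphi') _ _ hpsi; rewrite /= /Q.
rewrite correlationZr//; [|exact: bh_bm bpsi|exact: bh_bm bphi].
rewrite -mulrA normrM ger0_norm ?invr_ge0// ler_pdivrMl// => /le_trans; apply.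
by rewrite mulrC.
Qed.

(** * Sections and partial integrals of Hölder functions on a product *)

Section holder_product.
Context {R : realType} {X Y : metricType R}.
Implicit Types (psi : X * Y -> R) (a r : R).

(** Slices of the product are isometric to the factors for the sup distance, so sections keep the
    Hölder exponent and radius. *)
Lemma mdist_section1 (x x' : X) (y : Y) : mdist (x, y) (x', y) = mdist x x'.
Proof.
rewrite (_ : mdist _ _ = prod_mdist (x, y) (x', y))// /prod_mdist/= mdistxx.
exact/max_l/mdist_ge0.
Qed.

Lemma mdist_section2 (x : X) (y y' : Y) : mdist (x, y) (x, y') = mdist y y'.
Proof.
rewrite (_ : mdist _ _ = prod_mdist (x, y) (x, y'))// /prod_mdist/= mdistxx.
exact/max_r/mdist_ge0.
Qed.

Lemma holder_ball_section1 a r psi y :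
  holder_ball a r psi -> holder_ball a r (fun x => psi (x, y)).
Proof.
move=> [r0 psir H]; split=> // x x'.
by rewrite -(mdist_section1 x x' y).
Qed.

End holder_product.

(** The Hölder bound in [y] is uniform in [x], and averaging against a measure of mass one preserves
    it. *)
Lemma holder_ball_Rintegral1 (R : realType) d1 (X : measurableMetricType d1 R)
    (Y : metricType R) (mu : probability X R) (psi : X * Y -> R) a r :
  borel X -> compact [set: X] -> 0 < a -> a <= 1 ->
  holder_ball a r psi -> holder_ball a r (fun y => \int[mu]_x psi (x, y)).
Proof.
move=> bX cX a0 a1 hpsi; have [r0 psir H] := hpsi.
have mpsi y : measurable_fun setT (fun x => psi (x, y)).
  apply: (borel_continuous_measurableR bX).
  apply/holder_continuous_continuous/(holder_continuousP _ cX).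
  by exists a, r; split=> //; exact: holder_ball_section1.
split=> // [y|y y']; first exact: le_norm_Rintegral_probability.
rewrite -RintegralB//; try exact: bounded_integrable.
apply: le_norm_Rintegral_probability => [|x]; first exact: measurable_funB.
by rewrite -(mdist_section2 x y y').
Qed.

(** Measurability refers to the product sigma-algebra, so it does not follow directly from
    continuity on [X * Y]; uniform continuity in [x] together with measurability in [y] yields
    it. *)
Lemma holder_measurable_fun_prod (R : realType) d1 d2
    (X : measurableMetricType d1 R) (Y : measurableMetricType d2 R)
    (psi : X * Y -> R) :
  compact [set: X] -> compact [set: Y] -> borel X -> borel Y ->
  holder_continuous psi -> measurable_fun setT psi.
Proof.
move=> cX cY bX bY hpsi.
apply: measurable_fun_uniform_continuous1 => // [e e0|x].
  have [delta delta0 H] := holder_uniformly_continuous hpsi e0.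
  by exists delta => // x x' y xx'; apply: H; rewrite mdist_section1.
apply: (borel_continuous_measurableR bY); apply: holder_continuous_continuous.
have [a [C [a0 a1 H]]] := hpsi; exists a, C; split=> // y y'.
by rewrite -(mdist_section2 x y y').
Qed.

(** * Correlations of the product map *)

Lemma iter_product_map (X Y : Type) (f : X -> X) (g : Y -> Y) n z :
  iter n (product_map f g) z = (iter n f z.1, iter n g z.2).
Proof. by elim: n => [|n IHn] /=; [case: z|rewrite IHn]. Qed.

(** After Fubini, the integral over [y] of the product of the two partial integrals, the second
    taken at [iter n f2 y], is subtracted in [cor1] and added back in the correlation over [Y].
    Bounded measurability of [cor1] allows a bound uniform in [y] to be integrated. *)
Lemma correlation_product_map (R : realType) d1 d2 (X : measurableType d1)
    (Y : measurableType d2) (mu1 : probability X R) (mu2 : probability Y R)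
    (f1 : X -> X) (f2 : Y -> Y) (psi phi : X * Y -> R) n :
  measurable_fun setT f1 -> measurable_fun setT f2 ->
  bounded_measurable psi -> bounded_measurable phi ->
  let cor1 y := correlation mu1 (fun x => psi (x, y))
    (fun x => phi (x, iter n f2 y)) f1 n in
  bounded_measurable cor1 /\
  correlation (mu1 \x mu2)%E psi phi (product_map f1 f2) n =
  \int[mu2]_y cor1 y
  + correlation mu2 (fun y => \int[mu1]_x psi (x, y))
      (fun y => \int[mu1]_x phi (x, y)) f2 n.
Proof.
move=> mf1 mf2 bpsi bphi cor1.
have bphin : bounded_measurable (fun z => phi (iter n f1 z.1, iter n f2 z.2)).
  have [mphi [s phis]] := bphi; split; last by exists s.
  apply: measurableT_comp => //; apply: measurable_fun_pair.
    by apply: measurableT_comp => //; exact: measurable_fun_iter.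
  by apply: measurableT_comp => //; exact: measurable_fun_iter.
have bint (h : X * Y -> R) : bounded_measurable h ->
    bounded_measurable (fun y => \int[mu1]_x h (x, y)).
  move=> [mh [r hr]]; split.
    exact: (measurable_fun_Rintegral1 mu1 mu2 mh hr).
  exists r => y; apply: le_norm_Rintegral_probability => //.
  exact: measurable_fun_pair1.
have bprod := bounded_measurableM bpsi bphin.
have bInt := bounded_measurableM (bint _ bpsi)
  (bounded_measurable_iter mf2 n (bint _ bphi)).
have cor1E : cor1 = fun y => \int[mu1]_x (psi (x, y) *
    phi (iter n f1 x, iter n f2 y)) + (-1) * (\int[mu1]_x psi (x, y) *
    \int[mu1]_x phi (x, iter n f2 y)).
  by apply/funext => y; rewrite mulN1r.
split.
  rewrite cor1E; have [m1 [r1 H1]] := bint _ bprod; have [m2 [r2 H2]] := bInt.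
  split.
    apply: measurable_funD => //.
    exact: measurable_funM (measurable_cst _) m2.
  exists (r1 + r2) => y; rewrite mulN1r.
  by rewrite (le_trans (ler_normB _ _))// lerD.
rewrite cor1E RintegralDZ//; last exact: (bint _ bprod).
rewrite /correlation.
under eq_Rintegral do rewrite iter_product_map.
have [mpsi [r psir]] := bpsi; have [mphi [s phis]] := bphi.
have [mprod [t prodt]] := bprod.
rewrite (bounded_Fubini mu1 mu2 mprod prodt) (bounded_Fubini mu1 mu2 mpsi psir).
rewrite (bounded_Fubini mu1 mu2 mphi phis) /=; ring.
Qed.

Theorem corollary18 (R : realType) (d1 d2 : measure_display)
  (X : measurableMetricType d1 R) (Y : measurableMetricType d2 R)
  (manX : compact_manifold X) (manY : compact_manifold Y)
  (borelX : borel X) (borelY : borel Y)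
  (mu1 : probability X R) (mu2 : probability Y R)
  (f1 : X -> X) (f2 : Y -> Y)
  (homeo1 : homeomorphism f1) (homeo2 : homeomorphism f2)
  (pres1 : measure_preserving mu1 f1) (pres2 : measure_preserving mu2 f2)
  (gamma delta : R^nat)
  (decay1 : has_decay_rate mu1 f1 gamma)
  (decay2 : has_decay_rate mu2 f2 delta) :
  has_decay_rate (mu1 \x mu2)%E (product_map f1 f2)
    (fun n => Num.max (gamma n) (delta n)).
Proof.
have [[cX _] [cY _]] := (manX, manY).
have mf1 := borel_continuous_measurable borelX borelX homeo1.1.
have mf2 := borel_continuous_measurable borelY borelY homeo2.1.
have [gamma0 gammacvg _] := decay1; have [delta0 deltacvg Hdelta] := decay2.
have cXY : compact [set: X * Y] by rewrite -setXTT; exact: compact_setX.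
split=> [n||psi phi hpsi hphi].
- by rewrite le_max gamma0.
(* The maximum is squeezed between 0 and the sum of the two rates. *)
- have : gamma n + delta n @[n --> \oo] --> (0 + 0 : R) by exact: cvgD.
  rewrite addr0; apply: squeeze_cvgr; last exact: cvg_cst.
  near=> n; rewrite le_max gamma0/= ge_max.
  by rewrite lerDl lerDr gamma0 delta0.
have mpsi := holder_measurable_fun_prod cX cY borelX borelY hpsi.
have mphi := holder_measurable_fun_prod cX cY borelX borelY hphi.
have [a [r [a0 a1 psiar]]] := (holder_continuousP psi cXY).1 hpsi.
have [b [s [b0 b1 phibs]]] := (holder_continuousP phi cXY).1 hphi.
(* One constant [K] has to serve the sections at every [y] and at every [iter n f2 y], hence the
   uniform form of decay on [X]. On [Y] a single pair of observables occurs, so the plain decay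
   hypothesis suffices. *)
have [K [K0 HK]] := uniform_decay cX borelX mf1 decay1 a0 a1 b0 b1.
have [C HC] : exists C, forall n,
    `|correlation mu2 (fun y => \int[mu1]_x psi (x, y))
       (fun y => \int[mu1]_x phi (x, y)) f2 n| <= C * delta n.
  apply: Hdelta; apply/(holder_continuousP _ cY).
    by exists a, r; split=> //; exact: holder_ball_Rintegral1.
  by exists b, s; split=> //; exact: holder_ball_Rintegral1.
have bpsi : bounded_measurable psi by split=> //; exists r; case: psiar.
have bphi : bounded_measurable phi by split=> //; exists s; case: phibs.
have Krs0 : 0 <= K * r * s.
  by rewrite !mulr_ge0//; [case: psiar|case: phibs].
(* The absolute value allows [delta n] to be replaced by the larger maximum, since [C] may be
   negative. *)
exists (K * r * s + `|C|) => n.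
have [[mcor _] ->] := correlation_product_map mu1 mu2 n mf1 mf2 bpsi bphi.
rewrite mulrDl (le_trans (ler_normD _ _))// lerD//.
  apply: (@le_trans _ _ (K * r * s * gamma n)).
    apply: le_norm_Rintegral_probability => // y.
    by apply: HK; exact: holder_ball_section1.
  by rewrite ler_wpM2l// le_max lexx.
rewrite (le_trans (HC n))//.
apply: (@le_trans _ _ (`|C| * delta n)); first by rewrite ler_wpM2r// ler_norm.
by rewrite ler_wpM2l// le_max lexx orbT.
Unshelve. all: by end_near. Qed.
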